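(* Let $U\subseteq\mathbb C^p$ be a connected open subset and $f:U\to Z$ a holomorphic map. If $F_1,F_2:U\to V$ are holomorphic lifts of $f$ (i.e. holomorphic maps with $\pi\circ F_1=\pi\circ F_2=f$), then there exists $g\in G$ with $F_2=g\circ F_1$ on $U$. The same holds for local lifts of holomorphic germs: if $F_1,F_2:(\mathbb C^p,x)\to V$ are holomorphic germs with $\pi\circ F_1=\pi\circ F_2=f$ as germs at $x$, then $F_2=g\circ F_1$ as germs for some $g\in G$.
   Context: $V$ is a finite-dimensional complex vector space, $G\subset GL(V)$ a finite group, $Z=V/G$ the orbit space realized as $\sigma(V)\subseteq\mathbb C^m$ via a minimal system of homogeneous generators $\sigma=(\sigma_1,\dots,\sigma_m)$ of $\mathbb C[V]^G$, with quotient map $\pi=\sigma:V\to Z$. A holomorphic map into $Z$ means a holomorphic map into $\mathbb C^m$ with values in $Z$. *)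

(* Defs.v *)
From HB Require Import structures.
From mathcomp Require Import all_boot all_order all_algebra.
From mathcomp Require Import mpoly.
From mathcomp Require Import all_classical all_reals all_analysis.
From mathcomp Require Import complex.

Set Implicit Arguments.
Unset Strict Implicit.
Unset Printing Implicit Defensive.

Import Order.TTheory GRing.Theory Num.Theory.
Local Open Scope ring_scope.
Local Open Scope classical_set_scope.

(* The complex numbers: C := R[i] for an arbitrary real field R : realType.
   V = C^n is modelled by row vectors 'rV[C]_n; a matrix g : 'M[C]_n acts on V
   by the linear map  v |-> v *m g. *)

(* Equip C = R[i] with its norm topology (|z| = sqrt(Re^2+Im^2)), as the
   library does generically for numClosedFieldType; matrices 'M[C]_(m,n)
   then become normed C-modules (hence differentiability is over C). *)
HB.instance Definition _ (R : rcfType) := PseudoPointedMetric.copy R[i] (R[i])^o.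

Section Defs.
Variable (R : realType).
Local Notation C := (R[i]).

Definition finite_matrix_group (n : nat) (G : seq 'M[C]_n) : Prop :=
  [/\ (1%:M : 'M[C]_n) \in G,
      {in G &, forall a b, a *m b \in G} &
      {in G, forall a, a \in unitmx}].

(** The polynomial p o g, where g acts by v |-> v *m g, i.e.
    (p o g)(X) = p( (sum_i g i j X_i)_j ). *)
Definition act_mpoly (n : nat) (g : 'M[C]_n) (p : {mpoly C[n]}) : {mpoly C[n]} :=
  comp_mpoly [tuple \sum_(i < n) g i j *: 'X_i | j < n] p.

Definition invariant (n : nat) (G : seq 'M[C]_n) (p : {mpoly C[n]}) : Prop :=
  forall g, g \in G -> act_mpoly g p = p.

Definition in_gen_alg (n m : nat) (s : 'I_m -> {mpoly C[n]}) (p : {mpoly C[n]}) : Prop :=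
  exists q : {mpoly C[m]}, p = comp_mpoly [tuple s j | j < m] q.

Definition min_hom_generators (n m : nat) (G : seq 'M[C]_n)
    (sigma : 'I_m -> {mpoly C[n]}) : Prop :=
  [/\ (forall i, exists d : nat, sigma i \in d.-homog),
      (forall i, invariant G (sigma i)),
      (forall p, invariant G p -> in_gen_alg sigma p) &
      (forall i : 'I_m, ~ (forall p, invariant G p ->
          in_gen_alg (fun j => if j == i then 0 else sigma j) p))].

Definition quot_map (n m : nat) (sigma : 'I_m -> {mpoly C[n]}) (v : 'rV[C]_n) : 'rV[C]_m :=
  \row_(i < m) meval (fun j => v ord0 j) (sigma i).

Definition orbit_space (n m : nat) (sigma : 'I_m -> {mpoly C[n]}) : set 'rV[C]_m :=
  range (quot_map sigma).

(** Holomorphy: complex (Frechet) differentiability, the differential being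
    C-linear since the normed spaces are taken over the field C. *)
Definition holomorphic_on (p k : nat) (U : set 'rV[C]_p) (F : 'rV[C]_p -> 'rV[C]_k) : Prop :=
  forall x, U x -> differentiable F x.

Definition holomorphic_germ_at (p k : nat) (x : 'rV[C]_p) (F : 'rV[C]_p -> 'rV[C]_k) : Prop :=
  exists2 W : set 'rV[C]_p, nbhs x W & holomorphic_on W F.

End Defs.

(* Main.v *)
Require Import Defs.
From HB Require Import structures.
From mathcomp Require Import all_boot all_order all_algebra.
From mathcomp Require Import mpoly.
From mathcomp Require Import all_classical all_reals all_analysis.
From mathcomp Require Import complex.

From mathcomp Require Import ring lra.

Import Order.TTheory GRing.Theory Num.Theory.
Import numFieldNormedType.Exports.
Local Open Scope ring_scope.
Local Open Scope classical_set_scope.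

(** Invariant polynomials separate the orbits of G, so U is the union of the
    finitely many relatively closed sets E_g = {x | F2 x = g (F1 x)}, one of
    which must have an interior point; the identity theorem applied to the
    coordinates of F2 - g F1 then gives E_g = U.

    The identity theorem reduces, along complex lines, to one variable: if g is
    holomorphic for |z| <= 3 and vanishes near 1 then g(0) = 0. Indeed
    g(z) / (1 - z)^N is again holomorphic, and the mean value property over the
    circle |z| = 3, where |1 - z| >= 2, bounds g(0) by M / 2^N for every N. The
    mean value property follows from Goursat's theorem for the functions
    z |-> q (e^z) on rectangles of height 2 pi, whose horizontal sides cancel. *)

(** * Goursat's theorem on rectangles *)

(** Bisection: if a rectangle is bad, so is one of its quarters, and so on; the nested bad
    rectangles shrink to a point, near which [Good] is known to hold. *)
Lemma quartering (R : realType) (Good : R -> R -> R -> R -> Prop) (a b c d : R) :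
  a <= b -> c <= d ->
  (forall a b c d, a <= b -> c <= d ->
     Good a ((a + b) / 2) c ((c + d) / 2) ->
     Good ((a + b) / 2) b c ((c + d) / 2) ->
     Good a ((a + b) / 2) ((c + d) / 2) d ->
     Good ((a + b) / 2) b ((c + d) / 2) d -> Good a b c d) ->
  (forall x y, a <= x <= b -> c <= y <= d ->
     exists2 e : R, 0 < e & forall a' b' c' d', a' <= x <= b' -> c' <= y <= d' ->
       b' - a' < e -> d' - c' < e -> Good a' b' c' d') ->
  Good a b c d.
Proof.
move=> ab cd sub loc; apply: contrapT => bad0.
pose T := (R * R * R * R)%type.
pose bad (s : T) := let: (a, b, c, d) := s in ~ Good a b c d.
pose valid (s : T) := let: (a, b, c, d) := s in a <= b /\ c <= d.
pose quarter (s t : T) :=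
  let: (a, b, c, d) := s in let: (a', b', c', d') := t in
  [/\ a <= a', b' <= b, c <= c', d' <= d & b' - a' = (b - a) / 2 /\ d' - c' = (d - c) / 2].
have [S SP] : {S : T -> T & forall s, valid s -> bad s ->
    [/\ valid (S s), bad (S s) & quarter s (S s)]}.
  apply: (@choice T T (fun s t => valid s -> bad s -> [/\ valid t, bad t & quarter s t])) => -[[[a1 b1] c1] d1]; apply/not_existsP => H.
  have [[v1 v2] [nG _]] :
      (a1 <= b1 /\ c1 <= d1) /\ ~ Good a1 b1 c1 d1 /\ True.
    have := H (a1, b1, c1, d1) => /not_implyP[v /not_implyP[bb _]]; split; [exact: v | split; [exact: bb | exact: Logic.I]].
  (* A bad quarter would be a choice that [H] excludes, so all four quarters are good. *)
  apply: nG; apply: sub => //; apply: contrapT => nG'.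
  - apply: (H (a1, (a1 + b1) / 2, c1, (c1 + d1) / 2)) => _ _.
    by split => //=; split; lra.
  - apply: (H ((a1 + b1) / 2, b1, c1, (c1 + d1) / 2)) => _ _.
    by split => //=; split; lra.
  - apply: (H (a1, (a1 + b1) / 2, (c1 + d1) / 2, d1)) => _ _.
    by split => //=; split; lra.
  - apply: (H ((a1 + b1) / 2, b1, (c1 + d1) / 2, d1)) => _ _.
    by split => //=; split; lra.
pose s n := iter n S (a, b, c, d).
pose A n := (s n).1.1.1; pose B n := (s n).1.1.2.
pose C n := (s n).1.2; pose D n := (s n).2.
have sE n : s n = (A n, B n, C n, D n).
  by rewrite /A /B /C /D; case: (s n) => -[[]].
have sP n : valid (s n) /\ bad (s n).
  elim: n => [//|n [v bb]]; by have [] := SP _ v bb.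
have sQ n : quarter (s n) (s n.+1) by have [v bb] := sP n; have [] := SP _ v bb.
have vP n : A n <= B n /\ C n <= D n by have [] := sP n; rewrite sE.
have nG n : ~ Good (A n) (B n) (C n) (D n) by have [_] := sP n; rewrite sE.
have Q n : [/\ A n <= A n.+1, B n.+1 <= B n, C n <= C n.+1, D n.+1 <= D n &
    B n.+1 - A n.+1 = (B n - A n) / 2 /\ D n.+1 - C n.+1 = (D n - C n) / 2].
  by have := sQ n; rewrite !sE.
(* Nested intervals have a common point, namely the supremum of the left endpoints. *)
have point (X Y : nat -> R) : (forall n, X n <= Y n) ->
    (forall n, X n <= X n.+1) -> (forall n, Y n.+1 <= Y n) ->
    exists x, forall n, X n <= x <= Y n.
  move=> XY Xi Yd.
  have Xm m n : (m <= n)%N -> X m <= X n.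
    by apply: (@homo_leq _ X (fun x y => x <= y)) => // ? ? ?; exact: le_trans.
  have Ym m n : (m <= n)%N -> Y n <= Y m.
    by apply: (@homo_leq _ Y (fun x y => y <= x)) => // ? ? ? /[swap]; exact: le_trans.
  have XYmn m n : X m <= Y n.
    apply: (le_trans (Xm _ _ (leq_maxl m n))).
    exact: (le_trans (XY _) (Ym _ _ (leq_maxr m n))).
  exists (sup (range X)) => n; apply/andP; split.
    apply: ub_le_sup; last by exists n.
    by exists (Y 0%N) => _ [k _ <-].
  apply: ge_sup; first by exists (X 0%N); exists 0%N.
  by move=> _ [k _ <-].
have [x xP] : exists x, forall n, A n <= x <= B n.
  by apply: point => n; [case: (vP n)|case: (Q n)|case: (Q n)].
have [y yP] : exists x, forall n, C n <= x <= D n.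
  by apply: point => n; [case: (vP n)|case: (Q n)|case: (Q n)].
have [e e0 eP] := loc x y (xP 0%N) (yP 0%N).
have W n : B n - A n = (b - a) / 2 ^+ n /\ D n - C n = (d - c) / 2 ^+ n.
  elim: n => [|n [IH1 IH2]]; first by rewrite !expr0 !divr1.
  have [_ _ _ _ [-> ->]] := Q n; rewrite IH1 IH2.
  by rewrite -!mulrA -!invfM -!exprSr.
have small (w : R) : exists n : nat, `|w| / 2 ^+ n < e.
  have [n /= nP] : exists n : nat, `|w| / e < n%:R.
    by by exists (Num.trunc (`|w| / e)).+1; exact: truncnS_gt.
  exists n; rewrite ltr_pdivrMr ?exprn_gt0 // [e * _]mulrC -ltr_pdivrMr //.
  apply: (lt_le_trans nP); rewrite -natrX ler_nat; exact/ltnW/ltn_expl.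
(* The sum of the side lengths bounds each of them, so one [n] serves both directions. *)
have [n nP] := small (b - a + (d - c)).
apply: (nG n).
have [W1 W2] := W n.
rewrite ger0_norm in nP; last by lra.
have P0 : 0 < (2 : R) ^- n by rewrite invr_gt0 exprn_gt0.
apply: eP => //; rewrite ?W1 ?W2; apply: le_lt_trans nP; rewrite ler_pM2r //; lra.
Qed.

(** * Integrals over segments and around rectangles *)

Section Goursat.
Variable R : realType.
Implicit Types (f g : R -> R) (a b c d x y : R) (P Q : R -> R -> R).

(** Continuity is two-sided even at the endpoints; differentiability at the points of a closed
    rectangle supplies this. *)
Definition continuous_on_seg f a b := forall x, a <= x <= b -> {for x, continuous f}.

Definition seg_int f a b : R := Rintegral lebesgue_measure `[a, b] f.

Lemma continuous_on_seg_sub f a b c d : a <= c -> d <= b ->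
  continuous_on_seg f a b -> continuous_on_seg f c d.
Proof. by move=> ac db cf x /andP[cx xd]; apply: cf; lra. Qed.

Lemma continuous_on_seg_integrable f a b : continuous_on_seg f a b ->
  lebesgue_measure.-integrable `[a, b] (EFin \o f).
Proof.
move=> cf; apply: continuous_compact_integrable; first exact: segment_compact.
apply: continuous_in_subspaceT => x; rewrite inE/= in_itv/= => xab; exact: cf.
Qed.

Lemma seg_int_split f a c b : a <= c <= b -> continuous_on_seg f a b ->
  seg_int f a b = seg_int f a c + seg_int f c b.
Proof.
move=> /andP[ac cb] cf; rewrite /seg_int.
have ib : lebesgue_measure.-integrable `[c, b] (EFin \o f).
  exact/continuous_on_seg_integrable/(continuous_on_seg_sub _ _ _ _ _ ac (lexx b)).
(* The difference of the integrals over [a, b] and [a, c] is one over the half-open interval from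
   [c] to [b]; adding the endpoint [c] does not change it. *)
rewrite -[X in _ = _ + X]Rintegral_itv_obnd_cbnd; last first.
  apply: integrableS ib; [by []| by [] |].
  by move=> z /=; rewrite !in_itv/= => /andP[/ltW -> ->].
have E : Rintegral lebesgue_measure `[a, b] f - Rintegral lebesgue_measure `[a, c] f =
    Rintegral lebesgue_measure `]c, b] f.
  by apply: Rintegral_itvB; rewrite ?bnd_simp //; exact: continuous_on_seg_integrable.
by rewrite -E addrC subrK.
Qed.

Lemma seg_int_cst k a b : a <= b -> seg_int (fun=> k) a b = k * (b - a).
Proof.
move=> ab; rewrite /seg_int Rintegral_cst//= lebesgue_measure_itv/= lte_fin.
by case: ltgtP ab => //= -> _; rewrite subrr.
Qed.

Lemma le_seg_int f g a b : a <= b -> continuous_on_seg f a b -> continuous_on_seg g a b ->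
  (forall x, a <= x <= b -> f x <= g x) -> seg_int f a b <= seg_int g a b.
Proof.
move=> ab cf cg fg; apply: le_Rintegral => //; exact: continuous_on_seg_integrable.
Qed.

Lemma seg_intB f g a b : continuous_on_seg f a b -> continuous_on_seg g a b ->
  seg_int (fun x => f x - g x) a b = seg_int f a b - seg_int g a b.
Proof. by move=> cf cg; apply: RintegralB => //; exact: continuous_on_seg_integrable. Qed.

Lemma seg_int_near f k e a b : a <= b -> continuous_on_seg f a b ->
  (forall x, a <= x <= b -> `|f x - k| <= e) -> `|seg_int f a b - k * (b - a)| <= e * (b - a).
Proof.
move=> ab cf fk.
have cc r : continuous_on_seg (fun=> r) a b by move=> x _; exact: cvg_cst.
have H1 : seg_int f a b <= seg_int (fun=> k + e) a b.
  by apply: le_seg_int => // x /fk; rewrite ler_norml; lra.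
have H2 : seg_int (fun=> k - e) a b <= seg_int f a b.
  by apply: le_seg_int => // x /fk; rewrite ler_norml; lra.
by rewrite !seg_int_cst // in H1 H2; rewrite ler_norml; lra.
Qed.

(** Real differentiability at [(x, y)] with gradient [(p1, p2)], the error being measured in the
    norm |h| + |k|. *)
Definition lin_approx P x y p1 p2 := forall e, 0 < e -> exists2 d, 0 < d &
  forall h k, `|h| < d -> `|k| < d ->
    `|P (x + h) (y + k) - P x y - (p1 * h + p2 * k)| <= e * (`|h| + `|k|).

Lemma lin_approx_near P x y p1 p2 e : 0 < e -> lin_approx P x y p1 p2 ->
  exists2 d, 0 < d & forall h k, `|h| < d -> `|k| < d -> `|P (x + h) (y + k) - P x y| < e.
Proof.
move=> e0 /(_ 1 ltr01)[d d0 dP].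
(* With error constant 1 the increment of [P] is at most K (|h| + |k|), which is below [e] once |h|
   and |k| are below [e / (2 * K)]. *)
pose K := 2 + `|p1| + `|p2|.
have K0 : 0 < K by rewrite /K; have := normr_ge0 p1; have := normr_ge0 p2; lra.
exists (Num.min d (e / (2 * K))); first by rewrite lt_min d0 divr_gt0 //; lra.
move=> h k; rewrite !lt_min => /andP[hd he] /andP[kd ke].
have := dP h k hd kd.
set X := P _ _ - _ => HX.
have : `|X| <= K * (`|h| + `|k|).
  have -> : X = (X - (p1 * h + p2 * k)) + (p1 * h + p2 * k) by ring.
  apply: (le_trans (ler_normD _ _)).
  have := ler_normD (p1 * h) (p2 * k); rewrite !normrM => H.
  rewrite /K; have := normr_ge0 p1; have := normr_ge0 p2.
  have := normr_ge0 h; have := normr_ge0 k => *; nra.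
move=> /le_lt_trans; apply.
rewrite ltr_pdivlMr ?mulr_gt0// in he; rewrite ltr_pdivlMr ?mulr_gt0// in ke.
lra.
Qed.

Lemma lin_approx_cont1 P x y p1 p2 : lin_approx P x y p1 p2 -> {for x, continuous (P^~ y)}.
Proof.
move=> H; apply/cvgrPdist_lt => e e0.
have [d d0 dP] := lin_approx_near _ _ _ _ _ _ e0 H.
apply/nbhs_ballP; exists d => //= t; rewrite /ball /= distrC => td; rewrite distrC.
by have := dP (t - x) 0; rewrite subrKC addr0 normr0; apply.
Qed.

Lemma lin_approx_cont2 P x y p1 p2 : lin_approx P x y p1 p2 -> {for y, continuous (P x)}.
Proof.
move=> H; apply/cvgrPdist_lt => e e0.
have [d d0 dP] := lin_approx_near _ _ _ _ _ _ e0 H.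
apply/nbhs_ballP; exists d => //= t; rewrite /ball /= distrC => td; rewrite distrC.
by have := dP 0 (t - y); rewrite subrKC addr0 normr0; apply.
Qed.

(** The integral of P dx + Q dy along the boundary of [a, b] x [c, d], counterclockwise. *)
Definition circulation P Q a b c d :=
  seg_int (P^~ c) a b - seg_int (P^~ d) a b + seg_int (Q b) c d - seg_int (Q a) c d.

(** Only pointwise differentiability is required, as in Goursat's theorem; the
    shared coefficient p2 expresses dP/dy = dQ/dx. *)
Definition closed_form P Q a b c d := forall x y, a <= x <= b -> c <= y <= d ->
  exists p1 p2 q2, lin_approx P x y p1 p2 /\ lin_approx Q x y p2 q2.

Lemma closed_form_cont1 P Q a b c d y : closed_form P Q a b c d -> c <= y <= d ->
  continuous_on_seg (P^~ y) a b.
Proof.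
by move=> H yI x xI; have [p1 [p2 [q2 [/lin_approx_cont1]]]] := H x y xI yI.
Qed.

Lemma closed_form_cont2 P Q a b c d x : closed_form P Q a b c d -> a <= x <= b ->
  continuous_on_seg (Q x) c d.
Proof.
by move=> H xI y yI; have [p1 [p2 [q2 [_ /lin_approx_cont2]]]] := H x y xI yI.
Qed.

Lemma closed_form_sub P Q a b c d a' b' c' d' : a <= a' -> b' <= b -> c <= c' -> d' <= d ->
  closed_form P Q a b c d -> closed_form P Q a' b' c' d'.
Proof. by move=> ? ? ? ? H x y xI yI; apply: H; lra. Qed.

(** Each inner side is shared by two quarters, which traverse it in opposite directions. *)
Lemma circulation_quarters P Q a b c d m n : a <= m <= b -> c <= n <= d ->
  closed_form P Q a b c d ->
  circulation P Q a b c d = circulation P Q a m c n + circulation P Q m b c n +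
    (circulation P Q a m n d + circulation P Q m b n d).
Proof.
move=> mI nI H.
have cP y : c <= y <= d -> seg_int (P^~ y) a b = seg_int (P^~ y) a m + seg_int (P^~ y) m b.
  by move=> yI; apply: seg_int_split => //; apply: closed_form_cont1 H yI.
have cQ x : a <= x <= b -> seg_int (Q x) c d = seg_int (Q x) c n + seg_int (Q x) n d.
  by move=> xI; apply: seg_int_split => //; apply: closed_form_cont2 H xI.
rewrite /circulation !cP ?cQ; [ring|lra..].
Qed.

(** Replace [P] and [Q] by their affine approximations at [(x, y)]: opposite sides leave only p2 (c
    - d) (b - a) and p2 (b - a) (d - c), whose sum is 0. The error is at most [e * w] at each
    boundary point, in all 2 e w (b - a) + 2 e w (d - c) = 2 e w^2. *)
Lemma circulation_local P Q a b c d x y p1 p2 q2 e r : 0 < e ->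
  closed_form P Q a b c d -> a <= x <= b -> c <= y <= d ->
  (forall h k, `|h| < r -> `|k| < r ->
    `|P (x + h) (y + k) - P x y - (p1 * h + p2 * k)| <= e * (`|h| + `|k|)) ->
  (forall h k, `|h| < r -> `|k| < r ->
    `|Q (x + h) (y + k) - Q x y - (p2 * h + q2 * k)| <= e * (`|h| + `|k|)) ->
  b - a < r -> d - c < r ->
  `|circulation P Q a b c d| <= 2 * e * (b - a + (d - c)) ^+ 2.
Proof.
move=> e0 H xI yI PP QQ br dr; pose w := b - a + (d - c).
have ab : a <= b by lra.
have cd : c <= d by lra.
have cI : c <= c <= d by lra.
have dI : c <= d <= d by lra.
have aI : a <= a <= b by lra.
have bI : a <= b <= b by lra.
have cP := closed_form_cont1 _ _ _ _ _ _ _ H; have cQ := closed_form_cont2 _ _ _ _ _ _ _ H.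
have PB s t : a <= s <= b -> c <= t <= d ->
    `|P s t - P x y - (p1 * (s - x) + p2 * (t - y))| <= e * w.
  move=> sI tI; have := PP (s - x) (t - y); rewrite !subrKC => /(_ _ _)/le_trans; apply.
  - by rewrite ltr_norml; lra.
  - by rewrite ltr_norml; lra.
  - apply: ler_wpM2l; [exact: ltW | rewrite /w].
    by apply: lerD; rewrite ler_norml; lra.
have QB s t : a <= s <= b -> c <= t <= d ->
    `|Q s t - Q x y - (p2 * (s - x) + q2 * (t - y))| <= e * w.
  move=> sI tI; have := QQ (s - x) (t - y); rewrite !subrKC => /(_ _ _)/le_trans; apply.
  - by rewrite ltr_norml; lra.
  - by rewrite ltr_norml; lra.
  - apply: ler_wpM2l; [exact: ltW | rewrite /w].
    by apply: lerD; rewrite ler_norml; lra.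
have cB f g u v : continuous_on_seg f u v -> continuous_on_seg g u v ->
    continuous_on_seg (fun z => f z - g z) u v.
  by move=> cf cg z zI; apply: cvgB; [exact: cf | exact: cg].
have IP : `|seg_int (P^~ c) a b - seg_int (P^~ d) a b - p2 * (c - d) * (b - a)| <= 2 * (e * w) * (b - a).
  rewrite -seg_intB; [|exact: cP..].
  apply: seg_int_near => //; first by apply: cB; exact: cP.
  move=> s sI; have := PB s c sI cI; have := PB s d sI dI.
  by rewrite !ler_norml; lra.
have IQ : `|seg_int (Q b) c d - seg_int (Q a) c d - p2 * (b - a) * (d - c)| <= 2 * (e * w) * (d - c).
  rewrite -seg_intB; [|exact: cQ..].
  apply: seg_int_near => //; first by apply: cB; exact: cQ.
  move=> s sI; have := QB b s bI sI; have := QB a s aI sI.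
  by rewrite !ler_norml; lra.
have -> : 2 * e * (b - a + (d - c)) ^+ 2 = 2 * (e * w) * (b - a) + 2 * (e * w) * (d - c).
  by rewrite /w; ring.
apply: le_trans (lerD IP IQ); apply: le_trans (ler_normD _ _).
by rewrite le_eqVlt /circulation; apply/orP; left; apply/eqP; congr `|_|; ring.
Qed.

(** Goursat's theorem for the form P dx + Q dy. The bound 2 e (w + h)^2 for the
    circulation around a w x h rectangle is additive over the four quarters, so
    it is enough to have it for small rectangles around each point. *)
Lemma goursat P Q a b c d : a <= b -> c <= d -> closed_form P Q a b c d ->
  circulation P Q a b c d = 0.
Proof.
move=> ab cd H.
have small e : 0 < e -> `|circulation P Q a b c d| <= 2 * e * (b - a + (d - c)) ^+ 2.
  move=> e0.
  (* Containment in the original rectangle is built into [Good], so that [closed_form] is available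
     on every subrectangle. *)
  pose Good a' b' c' d' := a <= a' -> b' <= b -> c <= c' -> d' <= d ->
    `|circulation P Q a' b' c' d'| <= 2 * e * (b' - a' + (d' - c')) ^+ 2.
  apply: (@quartering _ Good a b c d) => //.
  - move=> a1 b1 c1 d1 ab1 cd1 G1 G2 G3 G4 aa bb cc dd.
    rewrite (circulation_quarters _ _ _ _ _ _ ((a1 + b1) / 2) ((c1 + d1) / 2));
      [|lra|lra|exact: closed_form_sub H].
    move: G1 => /(_ _ _ _ _)G1; move: G2 => /(_ _ _ _ _)G2.
    move: G3 => /(_ _ _ _ _)G3; move: G4 => /(_ _ _ _ _)G4.
    have -> : 2 * e * (b1 - a1 + (d1 - c1)) ^+ 2 =
        2 * e * ((a1 + b1) / 2 - a1 + ((c1 + d1) / 2 - c1)) ^+ 2 +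
        2 * e * (b1 - (a1 + b1) / 2 + ((c1 + d1) / 2 - c1)) ^+ 2 +
        (2 * e * ((a1 + b1) / 2 - a1 + (d1 - (c1 + d1) / 2)) ^+ 2 +
         2 * e * (b1 - (a1 + b1) / 2 + (d1 - (c1 + d1) / 2)) ^+ 2) by field.
    apply: (le_trans (ler_normD _ _)); apply: lerD;
      apply: (le_trans (ler_normD _ _)); apply: lerD.
    + by apply: G1; lra.
    + by apply: G2; lra.
    + by apply: G3; lra.
    + by apply: G4; lra.
  - move=> x y xI yI; have [p1 [p2 [q2 [/(_ e e0)[r r0 rP] /(_ e e0)[s s0 sP]]]]] := H x y xI yI.
    exists (Num.min r s); first by rewrite lt_min r0.
    move=> a1 b1 c1 d1 xI1 yI1; rewrite !lt_min => /andP[br bs] /andP[dr ds] aa bb cc dd.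
    apply: (circulation_local P Q a1 b1 c1 d1 x y p1 p2 q2 e (Num.min r s)) => //.
    + exact: closed_form_sub H.
    + by move=> h k; rewrite !lt_min => /andP[? _] /andP[? _]; exact: rP.
    + by move=> h k; rewrite !lt_min => /andP[_ ?] /andP[_ ?]; exact: sP.
    + by rewrite lt_min br.
    + by rewrite lt_min dr.
apply/eqP; rewrite -normr_le0; apply/ler_addgt0Pr => e e0; rewrite add0r.
pose W := (b - a + (d - c)) ^+ 2.
have W0 : 0 <= W by exact: sqr_ge0.
(* The bound becomes e W / (W + 1) <= e; the summand 1 keeps the denominator positive when the
   rectangle is a point. *)
apply: (le_trans (small (e / (2 * (W + 1))) _)); first by rewrite divr_gt0 // mulr_gt0 //; lra.
have -> : 2 * (e / (2 * (W + 1))) * W = e * W / (W + 1) by field; lra.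
rewrite ler_pdivrMr; last by lra.
by apply: ler_wpM2l; lra.
Qed.

End Goursat.

Arguments seg_int {R} f a b.
Arguments closed_form {R} P Q a b c d.

(** * Mean value property *)

(** The field is general so that this serves the real functions [expR], [cos], [sin] as well as
    complex functions. *)
Lemma derivable_approx (K : numFieldType) (f : K^o -> K^o) (x : K) : derivable f x 1 ->
  forall e : K, 0 < e -> exists2 d : K, 0 < d &
    forall h, `|h| < d -> `|f (x + h) - f x - 'D_1 f x * h| <= e * `|h|.
Proof.
move=> /derivable_nbhs /eqaddoP H e e0.
have /nbhs_ballP[d /= d0 dP] := H e e0.
exists d => // h hd.
have -> : f (x + h) - f x - 'D_1 f x * h =
    f (h *: (1 : K^o) + x) - (f x + h *: ('D_1 f x : K^o)).
  by rewrite [h *: 1]mulr1 [h + x]addrC opprD addrA [h *: _]mulrC.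
by apply: dP; rewrite /ball /= sub0r normrN.
Qed.

Section Polar.
Variable R : realType.
Local Notation C := R[i].
Local Open Scope complex_scope.
Implicit Types (x y h k e : R).

(** This is e^(x + iy); it wraps a vertical segment of length 2 pi once around the circle of radius
    e^x. *)
Definition cexp x y : C := (expR x * cos y) +i* (expR x * sin y).

Lemma cexpD x h y k : cexp (x + h) (y + k) = cexp x y * cexp h k.
Proof.
rewrite /cexp; simpc; rewrite expRD cosD sinD; apply/eqP; rewrite eq_complex /=.
by apply/andP; split; apply/eqP; ring.
Qed.

Lemma normc_le_ReIm (z : C) : `|z| <= (`|complex.Re z| + `|complex.Im z|)%:C.
Proof.
rewrite {1}[z]complexE; apply: (le_trans (ler_normD _ _)).
rewrite rmorphD /= lerD // ?normrM normc_def /= ?expr0n /= ?addr0 ?sqrtr_sqr ?lecR //.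
by rewrite expr1n add0r sqrtr1 mul1r normc_def /= expr0n addr0 sqrtr_sqr.
Qed.

Lemma normc_cexp x y : `|cexp x y| = (expR x)%:C.
Proof.
rewrite normc_def /= !exprMn -mulrDr cos2Dsin2 mulr1 sqrtr_sqr ger0_norm //.
Qed.

Lemma cexp_approx e : 0 < e -> exists2 d, 0 < d &
  forall h k, `|h| < d -> `|k| < d ->
    `|cexp h k - 1 - h +i* k| <= (e * (`|h| + `|k|))%:C.
Proof.
move=> e0.
(* [n] bounds |h|, |k| and the relative errors [a], [c], [s] below. As [n <= 1], |h + a| <= 2 |h|
   and |1 + h + a| <= 3, so the total error is at most n |h| + 8 n |k|. *)
have [n [n0 n1 ne]] : exists n : R, [/\ 0 < n, n <= 1 & 9 * n <= e].
  exists (Num.min 1 (e / 9)); split; first by rewrite lt_min ltr01 divr_gt0.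
    by rewrite ge_min lexx.
  have : Num.min 1 (e / 9) <= e / 9 by rewrite ge_min lexx orbT.
  lra.
have [d1 d10 H1] := @derivable_approx R expR 0 (@derivable_expR R 0) n n0.
have [d2 d20 H2] := @derivable_approx R cos 0 (@derivable_cos R 0) n n0.
have [d3 d30 H3] := @derivable_approx R sin 0 (@derivable_sin R 0) n n0.
exists (Num.min n (Num.min d1 (Num.min d2 d3))); first by rewrite !lt_min n0 d10 d20 d30.
move=> h k; rewrite !lt_min => /and4P[hn h1 h2 h3] /and4P[kn k1 k2 k3].
have {H1} := H1 h h1; have {H2} := H2 k k2; have {H3} := H3 k k3.
rewrite !add0r !derive_val expR0 sin0 cos0 oppr0 mul0r !mul1r !subr0 addr0.
set a := expR h - 1 - h; set c := cos k - 1; set s := sin k - k => Hs Hc Ha.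
apply: (le_trans (normc_le_ReIm _)); rewrite lecR /=.
have -> : expR h * cos k - 1 - h = a + c * (1 + h + a) by rewrite /a /c; ring.
have -> : expR h * sin k - 0 - k = s * (1 + h + a) + k * (h + a) by rewrite /a /s; ring.
have ah : `|h + a| <= 2 * `|h|.
  by apply: (le_trans (ler_normD _ _)); have := normr_ge0 h; nra.
have ah1 : `|1 + h + a| <= 3.
  rewrite -addrA; apply: (le_trans (ler_normD _ _)); rewrite normr1; lra.
have N1 : `|a + c * (1 + h + a)| <= n * `|h| + 3 * n * `|k|.
  apply: (le_trans (ler_normD _ _)); rewrite normrM; apply: lerD => //.
  have -> : 3 * n * `|k| = n * `|k| * 3 by ring.
  by apply: ler_pM.
have N2 : `|s * (1 + h + a) + k * (h + a)| <= 3 * n * `|k| + 2 * n * `|k|.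
  apply: (le_trans (ler_normD _ _)); rewrite !normrM; apply: lerD.
    have -> : 3 * n * `|k| = n * `|k| * 3 by ring.
    by apply: ler_pM.
  rewrite [leLHS]mulrC; apply: ler_wpM2r => //; lra.
apply: (le_trans (lerD N1 N2)); have := normr_ge0 h; have := normr_ge0 k; nra.
Qed.

(** Chain rule for q(e^s), with derivative z q'(z) where z = e^s. By [cexpD] a shift of s multiplies
    z by [cexp h k], so the expansion of the exponential at 0 suffices. The Cauchy-Riemann equations
    are contained in [D] acting by complex multiplication. *)
Lemma comp_cexp_approx (q : C^o -> C^o) x y : derivable q (cexp x y) 1 ->
  exists D : C, forall e, 0 < e -> exists2 d, 0 < d &
  forall h k, `|h| < d -> `|k| < d ->
    `|q (cexp (x + h) (y + k)) - q (cexp x y) - D * (h +i* k)| <= (e * (`|h| + `|k|))%:C.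
Proof.
move=> dq; set z := cexp x y; set D := 'D_1 q z.
exists (D * z) => e e0.
pose K : R := 1 + complex.Re `|D * z|.
have RN (w : C) : (complex.Re `|w|)%:C = `|w| by rewrite RRe_real // normr_real.
have ReN (w : C) : 0 <= complex.Re `|w| by rewrite -ler0c RN.
have K0 : 0 < K by rewrite /K; have := ReN (D * z); lra.
(* With S = |h| + |k|, the increment of z is at most L S, since |z| = e^x and |cexp h k - 1| <= 2
   S. *)
have [L L0 LE] : exists2 L : R, 0 < L & L = 2 * expR x.
  by exists (2 * expR x) => //; rewrite mulr_gt0 // expR_gt0.
have e1 : 0 < (e / (2 * L))%:C by rewrite ltcR divr_gt0 // mulr_gt0.
have [d1 d10 H1] := @derivable_approx _ q z dq _ e1.
have d1E : (complex.Re d1)%:C = d1 by rewrite RRe_real // gtr0_real.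
(* The bound 1 gives |E| <= S, from which [w] is estimated. The bound [e / (2 * K)], where [K]
   exceeds |D z|, makes D z E cost at most e S / 2; the other half is left to the error of [q]. *)
have e2 : 0 < Num.min 1 (e / (2 * K)) by rewrite lt_min ltr01 divr_gt0 // mulr_gt0.
have [d2 d20 H2] := cexp_approx _ e2.
have d1' : 0 < complex.Re d1 by rewrite -ltcR d1E.
exists (Num.min d2 (complex.Re d1 / (4 * L))).
  by rewrite lt_min d20 divr_gt0 // mulr_gt0.
move=> h k; rewrite !lt_min => /andP[h2 h1] /andP[k2 k1].
have {H2} := H2 h k h2 k2; set E := cexp h k - 1 - _ => HE.
pose S := `|h| + `|k|.
have S0 : 0 <= S by rewrite addr_ge0.
have hkS : `|h +i* k| <= S%:C by exact: normc_le_ReIm.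
set w := z * (cexp h k - 1).
have HE1 : `|E| <= S%:C.
  by apply: (le_trans HE); rewrite lecR ler_piMl // ge_min lexx.
have HE2 : `|E| <= (e / (2 * K) * S)%:C.
  by apply: (le_trans HE); rewrite lecR ler_wpM2r // ge_min lexx orbT.
have wS : `|w| <= (L * S)%:C.
  rewrite /w normrM normc_cexp.
  have -> : cexp h k - 1 = E + h +i* k by rewrite /E subrK.
  rewrite LE [2 * _]mulrC -mulrA rmorphM /=; apply: ler_wpM2l; first by rewrite ler0c expR_ge0.
  apply: (le_trans (ler_normD _ _)); rewrite mulr2n mulrDl !mul1r rmorphD; exact: lerD.
have wd : `|w| < d1.
  apply: (le_lt_trans wS); rewrite -d1E ltcR /S.
  rewrite ltr_pdivlMr ?mulr_gt0 // in h1; rewrite ltr_pdivlMr ?mulr_gt0 // in k1; lra.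
have {H1} := H1 w wd; rewrite -/D.
have -> : z + w = cexp (x + h) (y + k) by rewrite cexpD /w mulrBr mulr1 subrKC.
set A := _ - _ - _ => HA.
have -> : q (cexp (x + h) (y + k)) - q z - D * z * (h +i* k) = A + D * z * E.
  by rewrite /A /E /w; ring.
apply: (le_trans (ler_normD _ _)); rewrite -/S.
have -> : e * S = e / (2 * L) * (L * S) + e / 2 * S by field; lra.
rewrite rmorphD; apply: lerD.
  apply: (le_trans HA); rewrite [leRHS]rmorphM; apply: ler_wpM2l wS; exact: ltW.
rewrite normrM -[`|D * z|]RN.
have : (complex.Re `|D * z|)%:C * `|E| <= (complex.Re `|D * z|)%:C * (e / (2 * K) * S)%:C.
  by apply: ler_wpM2l HE2; rewrite ler0c.
move=> /le_trans; apply; rewrite -rmorphM lecR.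
have -> : e / 2 * S = K * (e / (2 * K) * S) by field; lra.
apply: ler_wpM2r; first by rewrite !mulr_ge0 ?invr_ge0 ?mulr_ge0 // ltW.
by rewrite /K; lra.
Qed.

Lemma normc_ge_Im (z : C) : `|complex.Im z|%:C <= `|z|.
Proof.
rewrite normc_def lecR -sqrtr_sqr ler_wsqrtr // lerDr; exact: sqr_ge0.
Qed.

(** These are the coefficients of Im (q(e^s) ds) for s = x + iy. *)
Lemma closed_form_cexp (q : C^o -> C^o) a b c d :
  (forall x y, a <= x <= b -> c <= y <= d -> derivable q (cexp x y) 1) ->
  closed_form (fun x y => complex.Im (q (cexp x y))) (fun x y => complex.Re (q (cexp x y)))
    a b c d.
Proof.
move=> dq x y xI yI; have [D DP] := comp_cexp_approx _ _ _ (dq x y xI yI).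
(* Im (D (h + ik)) = h Im D + k Re D and Re (D (h + ik)) = h Re D - k Im D; the shared coefficient
   is Re D. *)
exists (complex.Im D), (complex.Re D), (- complex.Im D).
split=> e e0; have [r r0 rP] := DP e e0; exists r => // h k hr kr;
  have := rP h k hr kr; set Z := q _ - _ - _ => HZ.
  rewrite -lecR; apply: le_trans HZ; apply: le_trans (normc_ge_Im _).
  rewrite lecR le_eqVlt; apply/orP; left; apply/eqP; congr `|_|.
  by rewrite /Z !raddfB /=; case: (D) => u v /=; ring.
rewrite -lecR; apply: le_trans HZ; apply: le_trans (normc_ge_Re _).
rewrite lecR le_eqVlt; apply/orP; left; apply/eqP; congr `|_|.
by rewrite /Z !raddfB /=; case: (D) => u v /=; ring.
Qed.

(** On the rectangle [a, b] x [0, 2 pi] periodicity cancels the horizontal sides, and the vertical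
    ones are the two integrals. *)
Lemma circle_mean_cst (q : C^o -> C^o) a b : a <= b ->
  (forall z : C, `|z| <= (expR b)%:C -> derivable q z 1) ->
  seg_int (fun y => complex.Re (q (cexp b y))) 0 (2 * pi) =
  seg_int (fun y => complex.Re (q (cexp a y))) 0 (2 * pi).
Proof.
move=> ab dq; have pi0 : 0 <= 2 * pi :> R by rewrite mulr_ge0 // pi_ge0.
have H : closed_form (fun x y => complex.Im (q (cexp x y)))
    (fun x y => complex.Re (q (cexp x y))) a b 0 (2 * pi).
  apply: closed_form_cexp => x y /andP[_ xb] _; apply: dq.
  by rewrite normc_cexp lecR ler_expR.
have := goursat _ _ _ _ _ _ _ ab pi0 H; rewrite /circulation.
have -> : (fun x : R => complex.Im (q (cexp x (2 * pi)))) = (fun x : R => complex.Im (q (cexp x 0))).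
  apply/funext => x; congr (complex.Im (q _)).
  by rewrite /cexp mulr_natl cos2pi sin2pi cos0 sin0.
by rewrite subrr add0r => /eqP; rewrite subr_eq0 => /eqP.
Qed.

(** The radius e^a of the inner circle is sent to 0. *)
Lemma circle_mean (q : C^o -> C^o) b :
  (forall z : C, `|z| <= (expR b)%:C -> derivable q z 1) ->
  seg_int (fun y => complex.Re (q (cexp b y))) 0 (2 * pi) = 2 * pi * complex.Re (q 0).
Proof.
move=> dq; have pi0 : 0 < 2 * pi :> R by rewrite mulr_gt0 // pi_gt0.
apply/eqP; rewrite -subr_eq0 -normr_le0; apply/ler_addgt0Pr => e e0; rewrite add0r.
have qc : {for (0 : C^o), continuous q}.
  apply/differentiable_continuous/derivable1_diffP; apply: dq.
  by rewrite normr0 lecR expR_ge0.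
have e1 : 0 < (e / (2 * pi))%:C by rewrite ltcR divr_gt0.
move/cvgrPdist_lt in qc.
have /nbhs_ballP[d /= d0 dP] := qc _ e1.
have dE : (complex.Re d)%:C = d by rewrite RRe_real // gtr0_real.
have d0' : 0 < complex.Re d by rewrite -ltcR dE.
(* The circle of radius e^a <= d / 2 lies in the disc where [q] is within [e / (2 * pi)] of [q 0];
   the minimum keeps [a <= b]. *)
pose a := Num.min b (ln (complex.Re d / 2)).
have ab : a <= b by rewrite ge_min lexx.
rewrite (circle_mean_cst q a b) // [2 * pi * _]mulrC -{2}[2 * pi]subr0.
have -> : e = e / (2 * pi) * (2 * pi - 0) by rewrite subr0 divfK // gt_eqF.
apply: seg_int_near; first exact: ltW.
  apply: (@closed_form_cont2 R (fun x y => complex.Im (q (cexp x y)))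
    (fun x y => complex.Re (q (cexp x y))) a b 0 (2 * pi)); last by rewrite lexx.
  apply: closed_form_cexp => x y /andP[_ xb] _; apply: dq.
  by rewrite normc_cexp lecR ler_expR.
move=> y _; rewrite -raddfB /= -lecR; apply: (le_trans (normc_ge_Re _)).
rewrite distrC; apply/ltW/dP; rewrite /ball /= sub0r normrN normc_cexp -dE ltcR.
apply: (@le_lt_trans _ _ (expR (ln (complex.Re d / 2)))).
  by rewrite ler_expR ge_min lexx orbT.
by rewrite lnK ?posrE; lra.
Qed.

Lemma mean_bound (q : C^o -> C^o) b M :
  (forall z : C, `|z| <= (expR b)%:C -> derivable q z 1) ->
  (forall y, 0 <= y <= 2 * pi -> `|q (cexp b y)| <= M%:C) -> `|complex.Re (q 0)| <= M.
Proof.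
move=> dq qM; have pi0 : 0 < 2 * pi :> R by rewrite mulr_gt0 // pi_gt0.
have := circle_mean q b dq; set I := seg_int _ _ _ => IE.
have : `|I - 0 * (2 * pi - 0)| <= M * (2 * pi - 0).
  apply: seg_int_near; first exact: ltW.
    (* Continuity along the circle is read off from the degenerate rectangle of width 0. *)
    apply: (@closed_form_cont2 R (fun x y => complex.Im (q (cexp x y)))
      (fun x y => complex.Re (q (cexp x y))) b b 0 (2 * pi)); last by rewrite lexx.
    apply: closed_form_cexp => x y /andP[_ xb] _; apply: dq.
    by rewrite normc_cexp lecR ler_expR.
  by move=> y yI; rewrite subr0 -lecR; apply: (le_trans (normc_ge_Re _)); exact: qM.
by rewrite mul0r !subr0 IE normrM gtr0_norm // mulrC ler_pM2r.
Qed.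

End Polar.

(** * Identity theorem *)

Section Identity.
Variable R : realType.
Local Notation C := R[i].
Local Open Scope complex_scope.

(** The extreme value theorem on the parameter interval [0, 2 pi] bounds |Re g| + |Im g|, which
    dominates |g|. *)
Lemma circle_bounded (g : C^o -> C^o) (b : R) :
  (forall z : C, `|z| <= (expR b)%:C -> derivable g z 1) ->
  exists2 M : R, 0 < M & forall y, 0 <= y <= 2 * pi -> `|g (cexp R b y)| <= M%:C.
Proof.
move=> dg; have pi0 : 0 <= 2 * pi :> R by rewrite mulr_ge0 // pi_ge0.
have H : closed_form (fun x y => complex.Im (g (cexp R x y)))
    (fun x y => complex.Re (g (cexp R x y))) b b 0 (2 * pi).
  apply: closed_form_cexp => x y /andP[_ xb] _; apply: dg.
  by rewrite normc_cexp lecR ler_expR.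
pose f (y : R) := `|complex.Re (g (cexp R b y))| + `|complex.Im (g (cexp R b y))|.
have cf : {within `[0, 2 * pi], continuous f}.
  apply: continuous_in_subspaceT => y; rewrite inE /= in_itv /= => yI.
  have bI : b <= b <= b by rewrite lexx.
  have [p1 [p2 [q2 [/lin_approx_cont2 cP /lin_approx_cont2 cQ]]]] := H b y bI yI.
  by apply: cvgD; apply: cvg_norm; [exact: cQ | exact: cP].
have [c _ cM] := EVT_max pi0 cf.
exists (1 + f c); first by rewrite ltr_pwDl ?addr_ge0.
move=> y yI; apply: (le_trans (normc_le_ReIm _ _)); rewrite lecR.
have := cM y; rewrite in_itv /= => /(_ yI); rewrite /f; lra.
Qed.

Lemma vanish_Re (g : C^o -> C^o) :
  (forall z : C, `|z| <= 3 -> derivable g z 1) ->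
  (\forall z \near (1 : C), g z = 0) -> complex.Re (g 0) = 0.
Proof.
move=> dg g1; pose b : R := ln 3.
have b3 : expR b = 3 by rewrite lnK // posrE.
have bC : (expR b)%:C = 3 :> C by rewrite b3 rmorph_nat.
have dg' z : `|z| <= (expR b)%:C -> derivable g z 1 by rewrite bC; exact: dg.
have [M M0 gM] := circle_bounded g b dg'.
have bound N : `|complex.Re (g 0)| <= M / 2 ^+ N.
  (* q vanishes near 1 (and at 1, where 0^-1 = 0), so it has no pole there. *)
  pose q (z : C^o) : C^o := g z * ((1 - z)^-1) ^+ N.+1.
  have dq z : `|z| <= (expR b)%:C -> derivable q z 1.
    move=> zb; have [->|z1] := eqVneq z 1.
      apply: (@near_eq_derivable _ _ _ (cst 0)); last exact: derivable_cst.
      by near=> t; rewrite /q (_ : g t = 0) ?mul0r //; near: t.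
    apply/derivable1_diffP; apply: differentiableM; first exact/derivable1_diffP/dg'.
    have -> : (fun z : C^o => (1 - z)^-1 ^+ N.+1) = (fun z : C^o => (1 - z)^-1 : C^o) ^+ N.+1.
      by rewrite exprfctE.
    apply: differentiableX; apply: differentiableV; last by rewrite subr_eq0 eq_sym.
    by apply: differentiableB; [exact: differentiable_cst | exact: ex_diff].
  have q0 : q 0 = g 0 by rewrite /q subr0 invr1 expr1n mulr1.
  rewrite -q0; apply: (mean_bound _ q b _ dq) => y yI.
  rewrite /q normrM normrX normfV rmorphM /=; apply: ler_pM => //; first exact: gM.
  have h2 : 2 <= `|1 - cexp R b y|.
    have := ler_normD (1 - cexp R b y) (-1).
    rewrite addrAC subrr add0r !normrN normr1 normc_cexp bC => h.
    by rewrite -(lerD2r 1) (le_trans _ h) // natr1.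
  rewrite fmorphV rmorphXn /= rmorph_nat -exprVn.
  have i0 : 0 <= `|1 - cexp R b y|^-1 by rewrite invr_ge0.
  have i2 : `|1 - cexp R b y|^-1 <= 2^-1.
    by rewrite lef_pV2 ?posrE // (lt_le_trans _ h2).
  (* Of the N + 1 factors |1 - z|^-1 one is estimated by 1 and the others by 1/2. *)
  rewrite exprS -[leRHS]mul1r; apply: ler_pM => //.
    by apply: (le_trans i2); rewrite invf_le1 // ler1n.
  by rewrite lerXn2r // nnegrE // ?(le_trans i0).
apply/eqP; rewrite -normr_le0; apply/ler_addgt0Pr => e e0; rewrite add0r.
(* Then M / e < N < 2^N. *)
pose N := (Num.trunc (M / e)).+1.
apply: (le_trans (bound N)); rewrite ler_pdivrMr ?exprn_gt0 // mulrC -ler_pdivrMr //.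
apply: (le_trans (ltW (truncnS_gt _))); rewrite -natrX ler_nat; exact/ltnW/ltn_expl.
Unshelve. all: by end_near. Qed.

(** The imaginary part of [g 0] is, up to sign, the real part of i g(0), so [vanish_Re] is applied
    to g and to i g. *)
Lemma vanish (g : C^o -> C^o) :
  (forall z : C, `|z| <= 3 -> derivable g z 1) ->
  (\forall z \near (1 : C), g z = 0) -> g 0 = 0.
Proof.
move=> dg g1; apply/eqP; rewrite eq_complex; apply/andP; split; apply/eqP.
  exact: vanish_Re.
have : complex.Re ('i%C * g 0) = 0.
  apply: (vanish_Re (fun z => 'i%C * g z)).
    move=> z /dg/derivable1_diffP dz; apply/derivable1_diffP.
    by apply: differentiableM => //; exact: differentiable_cst.
  by near=> z; rewrite (_ : g z = 0) ?mulr0 //; near: z.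
by case: (g 0) => u v /=; rewrite mul0r mul1r sub0r => /eqP; rewrite oppr_eq0 => /eqP.
Unshelve. all: by end_near. Qed.

(** * Several complex variables *)

Section SeveralVariables.
Variable p : nat.
Local Notation V := ('rV[C]_p).
Implicit Types (h : V -> C^o) (x y z : V).

(** For t in the disc |t| <= 3 the point z + t (y - z) stays at distance less
    than r / 8 + 3 r / 4 < r from x. *)
Lemma ball_vanish h x y z (r : C) : 0 < r ->
  (forall w, ball x r w -> differentiable h w) ->
  ball x (r / 8) y -> ball x (r / 8) z ->
  (\forall w \near y, h w = 0) -> h z = 0.
Proof.
move=> r0 dh; rewrite -!ball_normE /= => xy xz hy.
pose l (t : C^o) : V := z + t *: (y - z).
have dl t : differentiable l t.
  apply: differentiableD; first exact: differentiable_cst.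
  by apply: differentiableZl; exact: ex_diff.
have l0 : l 0 = z by rewrite /l scale0r addr0.
have l1 : l 1 = y by rewrite /l scale1r subrKC.
rewrite -l0; apply: (vanish (h \o l)).
  move=> t t3; apply/derivable1_diffP; apply: differentiable_comp => //.
  apply: dh; rewrite -ball_normE /= /l opprD addrA.
  apply: (le_lt_trans (ler_normB _ _)).
  rewrite normrZ.
  have yz : `|y - z| <= r / 4.
    have -> : y - z = (x - z) - (x - y) by rewrite opprB [RHS]addrC subrKA.
    apply: (le_trans (ler_normB _ _)).
    have -> : r / 4 = r / 8 + r / 8 by field.
    by rewrite lerD // ltW.
  have : `|t| * `|y - z| <= 3 * (r / 4) by apply: ler_pM.
  move=> hh; apply: (lt_le_trans (ltr_leD xz hh)).
  have -> : r / 8 + 3 * (r / 4) = r * (7 / 8) by field.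
  by rewrite ler_piMr // ?ltW // ltr_pdivrMr // mul1r ltr_nat.
have cl : l t @[t --> (1 : C^o)] --> y by rewrite -[X in _ --> X]l1; exact: differentiable_continuous.
exact: cl hy.
Qed.

(** The interior of the zero set is closed in [U]: a point [w] of its closure has some [v] of the
    interior within [r / 8], and [ball_vanish] then gives zeros on a whole ball around [w].
    Connectedness concludes. *)
Lemma identity_theorem (U : set V) h y : open U -> connected U ->
  (forall w, U w -> differentiable h w) -> U y ->
  (\forall w \near y, h w = 0) -> forall z, U z -> h z = 0.
Proof.
move=> oU cU dh Uy hy.
pose Z : set V := [set w | h w = 0].
suff E : U `&` interior Z = U by move=> z; rewrite -E => -[_ /interior_subset].
apply: cU.
- by exists y.
- by exists (interior Z) => //; exact: open_interior.
- exists (closure (interior Z)); first exact: closed_closure.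
  apply/seteqP; split=> w [Uw Zw]; split; [exact: Uw|exact: subset_closure|exact: Uw|].
  have [r /= r0 rU] : nbhs_ball w U by apply/nbhs_ballP; exact: open_nbhs_nbhs.
  have r8 : 0 < r / 8 by rewrite divr_gt0.
  have [v [Zv wv]] := Zw _ (nbhsx_ballx w _ r8).
  apply/nbhs_ballP; exists (r / 8) => // z wz.
  by apply: (ball_vanish h w v z r) => // u wu; apply: dh; exact: rU.
Qed.

End SeveralVariables.
End Identity.

(** * Orbit separation *)

Lemma comp_mpolyA (K : comNzRingType) (n k l : nat) (p : {mpoly K[n]})
    (s : n.-tuple {mpoly K[k]}) (t : k.-tuple {mpoly K[l]}) :
  comp_mpoly t (comp_mpoly s p) = comp_mpoly [tuple comp_mpoly t (tnth s i) | i < n] p.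
Proof.
rewrite [comp_mpoly s p]comp_mpolyEX [in RHS](mpolyE p) !raddf_sum /=; apply: eq_bigr => m _.
rewrite !comp_mpolyZ !comp_mpolyX rmorph_prod; congr (_ *: _).
by apply: eq_bigr => i _; rewrite rmorphXn tnth_mktuple.
Qed.

Section Orbits.
Variables (R : realType) (n : nat).
Local Notation C := R[i].
Implicit Types (g h : 'M[C]_n) (p : {mpoly C[n]}) (v w : 'rV[C]_n) (G : seq 'M[C]_n).

(** The order is reversed because matrices act on row vectors from the right: substituting v h into
    v g gives v (h g). *)
Lemma act_mpolyM g h p : act_mpoly h (act_mpoly g p) = act_mpoly (h *m g) p.
Proof.
rewrite /act_mpoly comp_mpolyA; apply: (congr1 (fun t => comp_mpoly t p)).
apply: eq_from_tnth => j.
rewrite !tnth_mktuple raddf_sum /=.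
under eq_bigr => i _ do rewrite comp_mpolyZ comp_mpolyXU -tnth_nth tnth_mktuple scaler_sumr.
rewrite exchange_big /=; apply: eq_bigr => k _; rewrite mxE scaler_suml.
by apply: eq_bigr => i _; rewrite scalerA mulrC.
Qed.

Lemma meval_act g p v :
  meval (fun j => v ord0 j) (act_mpoly g p) = meval (fun j => (v *m g) ord0 j) p.
Proof.
rewrite /act_mpoly comp_mpoly_meval; apply: meval_eq => j.
rewrite tnth_mktuple raddf_sum /= mxE; apply: eq_bigr => i _.
by rewrite mevalZ mevalXU mulrC.
Qed.

(** Acting by [h] permutes the factors. [undup] matters: if the list [G] repeats elements with
    different multiplicities, left multiplication need not preserve them. *)
Lemma invariant_prod G p : finite_matrix_group G ->
  Defs.invariant G (\prod_(g <- undup G) act_mpoly g p).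
Proof.
move=> [G1 GM GU] h hG.
have -> : act_mpoly h (\prod_(g <- undup G) act_mpoly g p) =
    \prod_(g <- undup G) act_mpoly (h *m g) p.
  by rewrite [LHS]rmorph_prod; apply: eq_bigr => g _; exact: act_mpolyM.
transitivity (\prod_(g <- map (mulmx h) (undup G)) act_mpoly g p).
  by rewrite big_map.
apply: perm_big.
have inj : injective (mulmx h : 'M[C]_n -> 'M[C]_n) by apply: can_inj (mulKmx (GU h hG)).
have um : uniq (map (mulmx h) (undup G)) by rewrite map_inj_uniq // undup_uniq.
apply: uniq_perm => //; first exact: undup_uniq.
have sub : {subset map (mulmx h) (undup G) <= undup G}.
  by move=> _ /mapP[g + ->]; rewrite !mem_undup => gG; exact: GM.
(* By counting, the injective left multiplication by [h] is onto. *)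
by have [] := uniq_min_size um sub; rewrite size_map.
Qed.

(** If [w] is not in the orbit of [v], some invariant polynomial distinguishes them; but it is a
    polynomial in [sigma], so its values depend only on [quot_map sigma]. *)
Lemma orbit_separation (m : nat) G (sigma : 'I_m -> {mpoly C[n]}) v w :
  finite_matrix_group G -> (forall p, Defs.invariant G p -> in_gen_alg sigma p) ->
  quot_map sigma v = quot_map sigma w -> exists2 g, g \in G & w = v *m g.
Proof.
move=> fG gen vw; apply: contrapT => no.
have [f fP] : {f : 'M[C]_n -> {mpoly C[n]} & forall g, g \in G ->
    meval (fun j => w ord0 j) (f g) = 1 /\ meval (fun j => (v *m g) ord0 j) (f g) = 0}.
  apply: (@choice _ _ (fun g f => g \in G ->
    meval (fun j => w ord0 j) f = 1 /\ meval (fun j => (v *m g) ord0 j) f = 0)) => g.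
  have [gG|] := boolP (g \in G); last by exists 0.
  have /rV0Pn[j] : w - v *m g != 0.
    by rewrite subr_eq0; apply/eqP => wE; apply: no; exists g.
  (* An affine polynomial in a coordinate where [w] and [v *m g] differ, scaled to be 1 at [w] and 0
     at [v *m g]. *)
  rewrite !mxE => wj; exists ((w ord0 j - (v *m g) ord0 j)^-1 *: ('X_j - ((v *m g) ord0 j)%:MP)) => _.
  rewrite !mevalZ !mevalB !mevalXU !mevalC subrr mulr0; split=> //.
  by rewrite mulVf // mxE.
(* p vanishes at w and equals 1 on the orbit of v; so the invariant polynomial
   obtained from it by taking the product over G separates v from w. *)
pose p := 1 - \prod_(g <- undup G) f g.
have pw : meval (fun j => w ord0 j) p = 0.
  rewrite mevalB meval1 rmorph_prod big_seq big1 ?subrr // => g.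
  by rewrite mem_undup => /fP[].
have pv g : g \in G -> meval (fun j => (v *m g) ord0 j) p = 1.
  move=> gG; rewrite mevalB meval1 rmorph_prod (big_rem g) ?mem_undup //=.
  by have [_ ->] := fP g gG; rewrite mul0r subr0.
have [q qE] := gen _ (invariant_prod G p fG).
have ev (u : 'rV[C]_n) : meval (fun j => u ord0 j) (\prod_(g <- undup G) act_mpoly g p) =
    meval (fun i => quot_map sigma u ord0 i) q.
  rewrite qE comp_mpoly_meval; apply: meval_eq => i.
  by rewrite tnth_mktuple mxE.
have : meval (fun j => v ord0 j) (\prod_(g <- undup G) act_mpoly g p) =
    meval (fun j => w ord0 j) (\prod_(g <- undup G) act_mpoly g p).
  by rewrite !ev vw.
have evE (u : 'rV[C]_n) : meval (fun j => u ord0 j) (\prod_(g <- undup G) act_mpoly g p) =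
    \prod_(g <- undup G) meval (fun j => (u *m g) ord0 j) p.
  by rewrite rmorph_prod; apply: eq_bigr => g _; exact: meval_act.
have [G1 _ _] := fG.
(* At [w] the factor of the identity is 0, while at [v] every factor is 1. *)
rewrite !evE [RHS](big_rem 1%:M) ?mem_undup //= mulmx1 pw mul0r big_seq big1.
  by move/eqP; rewrite oner_eq0.
by move=> g; rewrite mem_undup; exact: pv.
Qed.

End Orbits.

(** * Lifts *)

(** A finite Baire argument by induction on [s]: either the first set contains [O], or a nonempty
    open part of [O] avoids it and is covered by the remaining sets. *)
Lemma finite_closed_cover_interior (T : topologicalType) (I : eqType) (s : seq I)
    (E : I -> set T) (O : set T) (x : T) :
  open O -> O x ->
  (forall g y, g \in s -> O y -> ~ E g y -> nbhs y (~` E g)) ->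
  (forall y, O y -> exists2 g, g \in s & E g y) ->
  exists2 g, g \in s & exists2 y, O y & nbhs y (E g).
Proof.
elim: s O x => [|g s IH] O x oO Ox cE cov; first by have [g] := cov x Ox.
have [OE|] := pselect (O `<=` E g).
  exists g; first exact: mem_head.
  by exists x => //; apply: filterS OE _; exact: open_nbhs_nbhs.
move=> /existsNP[y /not_implyP[Oy nEy]].
have yO : (O `&` ~` E g)° y.
  apply: filterI; first exact: open_nbhs_nbhs.
  exact: cE (mem_head _ _) Oy nEy.
have [|h z hs /interior_subset[Oz _]|z /interior_subset[Oz nEz]|h hs [z]] :=
  IH (O `&` ~` E g)° y _ yO.
- exact: open_interior.
- by apply: cE => //; rewrite in_cons hs orbT.
- have [h] := cov z Oz; rewrite in_cons => /predU1P[-> //|hs hE].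
  by exists h.
- move=> /interior_subset[Oz _] zE.
  by exists h; [rewrite in_cons hs orbT | exists z].
Qed.

Section Lifts.
Variables (R : realType) (n p : nat).
Local Notation C := R[i].
Implicit Types (F : 'rV[C]_p -> 'rV[C]_n) (g : 'M[C]_n) (U : set 'rV[C]_p).

Definition lift_diff F1 F2 g (j : 'I_n) (x : 'rV[C]_p) : C^o := (F2 x - F1 x *m g) ord0 j.

Lemma lift_diff_eq0 F1 F2 g x : (forall j, lift_diff F1 F2 g j x = 0) <-> F2 x = F1 x *m g.
Proof.
split=> [H|H j]; last by rewrite /lift_diff H subrr mxE.
by apply/eqP; rewrite -subr_eq0; apply/eqP/rowP => j; rewrite [RHS]mxE; exact: H.
Qed.

Lemma lift_diff_near0 F1 F2 g (y : 'rV[C]_p) : (\forall x \near y, F2 x = F1 x *m g) ->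
  forall j, \forall x \near y, lift_diff F1 F2 g j x = 0.
Proof. by move=> H j; apply: filterS H => x /lift_diff_eq0. Qed.

Lemma differentiable_lift_diff F1 F2 g j x : differentiable F1 x -> differentiable F2 x ->
  differentiable (lift_diff F1 F2 g j) x.
Proof.
move=> d1 d2.
have dc F i : differentiable F x -> differentiable (fun y => F y ord0 i : C^o) x.
  by move=> dF; apply: (differentiable_comp (g := fun N : 'rV[C]_n => N ord0 i : C^o) dF);
    exact: differentiable_coord.
have -> : lift_diff F1 F2 g j =
    (fun y => F2 y ord0 j : C^o) - \sum_(i < n) (fun y => g i j *: (F1 y ord0 i : C^o)).
  apply/funext => y; rewrite /lift_diff !mxE; congr (_ - _).
  by rewrite fct_sumE; apply: eq_bigr => i _; rewrite [RHS]mulrC.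
apply: differentiableB; first exact: dc.
apply: differentiable_sum => i; apply: differentiableZ; exact: dc.
Qed.

(** For fixed [g] the agreement set is closed in [U]: where some coordinate of the difference is
    nonzero, it stays nonzero nearby by continuity. *)
Lemma lifts_agree_somewhere (G : seq 'M[C]_n) U F1 F2 x : open U -> U x ->
  holomorphic_on U F1 -> holomorphic_on U F2 ->
  (forall y, U y -> exists2 g, g \in G & F2 y = F1 y *m g) ->
  exists2 g, g \in G & exists2 y, U y & \forall z \near y, F2 z = F1 z *m g.
Proof.
move=> oU Ux d1 d2 cov.
apply: (finite_closed_cover_interior _ _ G (fun g => [set z | F2 z = F1 z *m g]) U x) => //.
move=> g y _ Uy /= ne.
have [j] : exists j, lift_diff F1 F2 g j y != 0.
  apply: contrapT => no; apply: ne; apply/lift_diff_eq0 => j.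
  by apply/eqP; apply: contrapT => /negP ?; apply: no; exists j.
move=> nz.
have := differentiable_continuous (differentiable_lift_diff F1 F2 g j y (d1 y Uy) (d2 y Uy)).
move=> /cvgr_neq0 /(_ nz); apply: filterS => z; apply: contra_neq_not => /lift_diff_eq0; exact.
Qed.

End Lifts.

Theorem theorem2p7 (R : realType) (n m p : nat) (G : seq 'M[R[i]]_n)
    (sigma : 'I_m -> {mpoly R[i][n]}) :
  finite_matrix_group G ->
  min_hom_generators G sigma ->
  (* global version on a connected open U *)
  (forall (U : set 'rV[R[i]]_p) (f : 'rV[R[i]]_p -> 'rV[R[i]]_m)
          (F1 F2 : 'rV[R[i]]_p -> 'rV[R[i]]_n),
      open U -> connected U ->
      holomorphic_on U f -> (forall x, U x -> orbit_space sigma (f x)) ->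
      holomorphic_on U F1 -> holomorphic_on U F2 ->
      (forall x, U x -> quot_map sigma (F1 x) = f x) ->
      (forall x, U x -> quot_map sigma (F2 x) = f x) ->
      exists2 g, g \in G & forall x, U x -> F2 x = F1 x *m g)
  /\
  (* germ version at a point x *)
  (forall (x : 'rV[R[i]]_p) (f : 'rV[R[i]]_p -> 'rV[R[i]]_m)
          (F1 F2 : 'rV[R[i]]_p -> 'rV[R[i]]_n),
      holomorphic_germ_at x f -> (\forall y \near x, orbit_space sigma (f y)) ->
      holomorphic_germ_at x F1 -> holomorphic_germ_at x F2 ->
      (\forall y \near x, quot_map sigma (F1 y) = f y) ->
      (\forall y \near x, quot_map sigma (F2 y) = f y) ->
      exists2 g, g \in G & \forall y \near x, F2 y = F1 y *m g).
Proof.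
move=> fG [_ _ gen _].
have orb (F1 F2 : 'rV[R[i]]_p -> 'rV[R[i]]_n) (f : 'rV[R[i]]_p -> 'rV[R[i]]_m) x :
    quot_map sigma (F1 x) = f x -> quot_map sigma (F2 x) = f x ->
    exists2 g, g \in G & F2 x = F1 x *m g.
  by move=> e1 e2; apply: (orbit_separation _ _ _ G sigma) => //; rewrite e1.
split.
- move=> U f F1 F2 oU cU _ _ d1 d2 e1 e2.
  (* The empty set counts as connected; there the identity matrix serves. *)
  have [[x Ux]|] := pselect (exists x, U x); last first.
    move=> U0; exists 1%:M; first by case: fG.
    by move=> x Ux; case: U0; exists x.
  have [g gG [y Uy yE]] := lifts_agree_somewhere _ _ _ G U F1 F2 x oU Ux d1 d2
    (fun y Uy => orb F1 F2 f y (e1 y Uy) (e2 y Uy)).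
  exists g => // z Uz; apply/lift_diff_eq0 => j.
  apply: (identity_theorem _ _ U (lift_diff _ _ _ F1 F2 g j) y) => //.
    by move=> w Uw; apply: differentiable_lift_diff; [exact: d1|exact: d2].
  exact: lift_diff_near0.
- move=> x f F1 F2 _ _ [W1 xW1 d1] [W2 xW2 d2] e1 e2.
  have : \forall y \near x, [/\ W1 y, W2 y, quot_map sigma (F1 y) = f y &
      quot_map sigma (F2 y) = f y].
    by near=> y; split; near: y.
  move=> /nbhs_ballP[r /= r0 rP].
  have r8 : 0 < r / 8 by rewrite divr_gt0.
  have sub y : ball x (r / 8) y -> ball x r y.
    by apply: le_ball; rewrite ler_piMr ?ltW // invf_lt1 // ltr1n.
  (* Passing to the interior of the ball gives an open set containing [x]. *)
  have oB : open (ball x (r / 8))° by exact: open_interior.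
  have xB : (ball x (r / 8))° x by exact: nbhsx_ballx.
  have [g gG [y yB yE]] : exists2 g, g \in G & exists2 y, (ball x (r / 8))° y &
      \forall z \near y, F2 z = F1 z *m g.
    apply: (lifts_agree_somewhere _ _ _ G _ F1 F2 x oB xB).
    + by move=> y /interior_subset/sub/rP[/d1].
    + by move=> y /interior_subset/sub/rP[_ /d2].
    + by move=> y /interior_subset/sub/rP[_ _ ? ?]; exact: (orb F1 F2 f).
  exists g; first exact: gG.
  (* The agreement near [y] spreads to the whole ball of radius [r / 8] by [ball_vanish], as the
     lifts are holomorphic on the ball of radius [r]. *)
  apply/nbhs_ballP; exists (r / 8); first exact: r8.
  move=> z zB; apply/lift_diff_eq0 => j.
  apply: (ball_vanish _ _ (lift_diff _ _ _ F1 F2 g j) x y z r).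
  + exact: r0.
  + by move=> w /rP[/d1 ? /d2 ? _ _]; exact: differentiable_lift_diff.
  + exact: interior_subset yB.
  + exact: zB.
  + exact: lift_diff_near0.
Unshelve. all: by end_near. Qed.
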